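(* Every real algebraic number $\alpha$ is GapL approximable; that is, there exist GapL functions $f,g$ such that for all $n\geq 0$, $g(1^n)\neq 0$ and $\left|\frac{f(1^n)}{g(1^n)}-\alpha\right|<2^{-n}$.
   Context: A GapL function is a function $f:\Sigma^{\ast}\to\mathbb{Z}$ for which there is a nondeterministic Turing machine $M$ running in logarithmic space such that $f(x)$ equals the number of accepting computation paths of $M$ on $x$ minus the number of rejecting computation paths of $M$ on $x$, for every $x$. A real number $\alpha$ is called GapL approximable if there exist GapL functions $f,g$ such that for all $n\geq0$, $g(1^n)\neq0$ and $|f(1^n)/g(1^n)-\alpha|<2^{-n}$. *)

(* Defs.v *)
From HB Require Import structures.
From mathcomp Require Import all_boot all_order all_algebra.
From mathcomp Require Import reals.

Set Implicit Arguments.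
Unset Strict Implicit.
Unset Printing Implicit Defensive.

Import Order.TTheory GRing.Theory Num.Theory.
Local Open Scope ring_scope.

Inductive dir := GoLeft | Stay | GoRight.

Definition dir_code (d : dir) : option bool :=
  match d with GoLeft => Some false | Stay => None | GoRight => Some true end.
Definition dir_decode (o : option bool) : dir :=
  match o with Some false => GoLeft | None => Stay | Some true => GoRight end.
Lemma dir_codeK : cancel dir_code dir_decode. Proof. by case. Qed.
HB.instance Definition _ := Finite.copy dir (can_type dir_codeK).

(* The input word is delimited by two end markers. *)
Inductive insym (Sigma : Type) := LeftMark | RightMark | Letter of Sigma.
Arguments LeftMark {Sigma}.
Arguments RightMark {Sigma}.

(* A nondeterministic Turing machine with a two-way read-only input tape and
   one two-way infinite work tape. In a move (q, b, di, dw), q is the new state,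
   b the symbol written on the work tape, and di and dw are the movements of the
   input and work heads. The input head may not leave the marked region. *)
Record ntm (Sigma : finType) := NTM {
  state : finType;
  wsym : finType;
  blank : wsym;
  start : state;
  accepting : {set state};
  delta : state -> insym Sigma -> wsym -> {set state * wsym * dir * dir};
  delta_left : forall q g q' b dw,
    (q', b, GoLeft, dw) \notin delta q LeftMark g;
  delta_right : forall q g q' b dw,
    (q', b, GoRight, dw) \notin delta q RightMark g
}.

Section Machine.
Variables (Sigma : finType) (M : ntm Sigma).

Definition move : eqType := (state M * wsym M * dir * dir)%type.

Record config := Config {
  cstate : state M;
  ipos : nat;
  wtape : int -> wsym M;
  wpos : int
}.

Definition init : config := Config (start M) 0 (fun=> blank M) 0.

(* Input position 0 holds the left marker, positions 1, ..., size x the letters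
   of x, and position size x + 1 the right marker; [delta_left] and
   [delta_right] keep the head in this range. *)
Definition read_input (x : seq Sigma) (i : nat) : insym Sigma :=
  if i is j.+1 then
    if onth x j is Some a then Letter a else RightMark
  else LeftMark.

Definition moves (x : seq Sigma) (c : config) : {set state M * wsym M * dir * dir} :=
  delta (cstate c) (read_input x (ipos c)) (wtape c (wpos c)).

Definition move_ipos (d : dir) (i : nat) : nat :=
  match d with GoLeft => i.-1 | Stay => i | GoRight => i.+1 end.

Definition move_wpos (d : dir) (i : int) : int :=
  match d with GoLeft => i - 1 | Stay => i | GoRight => i + 1 end.

Definition step (c : config) (m : move) : config :=
  let: (q, b, di, dw) := m in
  Config q (move_ipos di (ipos c))
    (fun i => if i == wpos c then b else wtape c i)
    (move_wpos dw (wpos c)).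

(* A computation path is recorded as its sequence of moves. Distinct moves
   from a configuration lead to distinct configurations, so this is the same
   as recording the sequence of configurations. *)
Fixpoint run_from (x : seq Sigma) (c : config) (p : seq move) : option config :=
  if p is m :: p' then
    if m \in moves x c then run_from x (step c m) p' else None
  else Some c.

Definition run (x : seq Sigma) (p : seq move) : option config :=
  run_from x init p.

Definition halted (x : seq Sigma) (c : config) : bool := moves x c == set0.

Definition accepting_path (x : seq Sigma) : pred (seq move) := fun p =>
  if run x p is Some c then halted x c && (cstate c \in accepting M) else false.

Definition rejecting_path (x : seq Sigma) : pred (seq move) := fun p =>
  if run x p is Some c then halted x c && (cstate c \notin accepting M) else false.

(* Every computation on every input is finite: since branching is finite, a
   uniform bound on the length of the computations on x amounts to the absence
   of infinite ones. *)
Definition always_halts : Prop :=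
  forall x : seq Sigma, exists T : nat, forall p c, run x p = Some c -> (size p <= T)%N.

(* The work cells scanned form an interval containing cell 0, so bounding the
   distance of the work head to cell 0 bounds, up to a constant factor, the
   number of cells used. The successor makes the bound positive on short
   inputs. *)
Definition logspace : Prop :=
  exists k : nat, forall x p c,
    run x p = Some c -> (`|wpos c| <= k * (trunc_log 2 (size x)).+1)%N.

End Machine.

Arguments init {Sigma} M.
Arguments run {Sigma} M x p.
Arguments accepting_path {Sigma} M x p.
Arguments rejecting_path {Sigma} M x p.

Definition has_count (T : eqType) (P : pred T) (n : nat) : Prop :=
  exists s : seq T, [/\ uniq s, forall x, (x \in s) = P x & size s = n].

Definition GapL (Sigma : finType) (f : seq Sigma -> int) : Prop :=
  exists M : ntm Sigma, [/\ always_halts M, logspace M &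
    forall x, exists a r : nat,
      [/\ has_count (accepting_path M x) a,
          has_count (rejecting_path M x) r &
          f x = a%:Z - r%:Z]].

(* [one] is the letter 1 of the alphabet, and [nseq n one] the word 1^n. *)
Definition GapL_approximable (R : realType) (Sigma : finType) (one : Sigma)
    (alpha : R) : Prop :=
  exists f g : seq Sigma -> int, [/\ GapL f, GapL g &
    forall n : nat,
      g (nseq n one) != 0 /\
      `|(f (nseq n one))%:~R / (g (nseq n one))%:~R - alpha| < 2 ^- n].

(* Main.v *)
(** Pick a rational [r <> alpha] very close to [alpha] and an integer multiple [P]
    of [p(X + r)], where [alpha] is a simple root of [p]; then
    [delta = alpha - r] is a small simple root and [P = (X - delta) Q].
    If [1/P = \sum u_n X^n] (Bernoulli's method), the numbers
    [t_n = u_(n-1) - delta u_n] are the coefficients of [1/Q]; they grow at most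
    like [B^n] with [B] independent of [r], whereas [u_n] grows at least like
    [(4B)^n] once [delta] is small, so that [u_n / u_(n+1)] tends to [delta] at
    rate [4^-n]. Now [v_n = P_0^(n+1) u_n] is an integer sequence with a constant
    coefficient linear recurrence, hence a signed count of walks of length [n]
    in a fixed finite graph, which a machine that never uses its work tape
    realizes by moving right over its input. *)

Require Import Defs.
From mathcomp Require Import all_boot all_order all_algebra.
From mathcomp Require Import reals zify ring lra.
Set Implicit Arguments.
Unset Strict Implicit.
Unset Printing Implicit Defensive.
Import Order.TTheory GRing.Theory Num.Theory.
Local Open Scope ring_scope.

(** * Gaps of machines and automata *)

Section HaltingPaths.
Variables (Sigma : finType) (M : ntm Sigma) (x : seq Sigma).

Fixpoint halting_paths (n : nat) (c : config M) : seq (seq (move M)) :=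
  if halted x c then [:: [::]]
  else if n is n'.+1 then
    [seq m :: p | m <- enum (moves x c), p <- halting_paths n' (step c m)]
  else [::].

Definition halting_from (P : pred (config M)) (c : config M) : pred (seq (move M)) :=
  fun p => if run_from x c p is Some c' then halted x c' && P c' else false.

(** The length bound keeps the fuel [n] from running out: at fuel 0, a configuration that still has
    a move would start a path of length 1. *)
Lemma mem_halting_paths n c p :
  (forall p' c', run_from x c p' = Some c' -> (size p' <= n)%N) ->
  (p \in halting_paths n c) = halting_from predT c p.
Proof.
rewrite /halting_from.
elim: n c p => [|n IHn] c p bnd /=.
  case: ifPn => [hc | nhc]; last first.
    have /set0Pn [m mc] : moves x c != set0 by [].
    by have := bnd [:: m] _ _; rewrite /= mc => /(_ _ erefl).
  case: p => [|m p] /=; first by rewrite hc.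
  by rewrite inE (eqP hc) inE.
case: ifPn => [hc | nhc].
  case: p => [|m p] /=; first by rewrite hc.
  by rewrite inE (eqP hc) inE.
apply/idP/idP.
  move=> /allpairsPdep [m [p' [mc p'c ->]]] /=.
  rewrite mem_enum in mc; rewrite mc -IHn // => p1 c1 r1.
  by have := bnd (m :: p1) c1; rewrite /= mc r1 => /(_ erefl).
case: p => [|m p] /=; first by rewrite (negPf nhc).
case: ifP => // mc hp.
apply/allpairsPdep; exists m, p; split; rewrite ?mem_enum //.
rewrite IHn // => p1 c1 r1.
by have := bnd (m :: p1) c1; rewrite /= mc r1 => /(_ erefl).
Qed.

Lemma halting_paths_uniq n c : uniq (halting_paths n c).
Proof.
elim: n c => [|n IHn] c /=; case: ifP => // _.
apply: allpairs_uniq_dep => [||[m p] [m' p'] _ _ /= [-> ->]] //.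
exact: enum_uniq.
Qed.

Fixpoint gap (n : nat) (c : config M) : int :=
  if halted x c then (-1) ^+ (cstate c \notin accepting M)
  else if n is n'.+1 then \sum_(m in moves x c) gap n' (step c m) else 0.

Lemma gap_count n c :
  gap n c = (count (halting_from (fun c' => cstate c' \in accepting M) c)
                   (halting_paths n c))%:Z
          - (count (halting_from (fun c' => cstate c' \notin accepting M) c)
                   (halting_paths n c))%:Z.
Proof.
rewrite /halting_from; elim: n c => [|n IHn] c /=.
  by case: ifP => // hc; rewrite /= hc; case: (_ \in _).
case: ifP => hc; first by rewrite /= hc; case: (_ \in _).
rewrite !count_flatten -!map_comp !sumnE !big_map !big_enum /=.
rewrite !(big_morph Posz PoszD (erefl 0%:Z)) -sumrB.
apply: eq_bigr => m mc; rewrite IHn /= !count_map.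
by congr (Posz _ - Posz _); apply: eq_count => p /=; rewrite mc.
Qed.

End HaltingPaths.

(** An explicit time bound [T] serves as fuel, so the difference of path counts becomes a
    recursively computed integer. *)
Lemma GapL_gap (Sigma : finType) (M : ntm Sigma) (T : seq Sigma -> nat) :
  (forall x p c, run M x p = Some c -> (size p <= T x)%N) -> logspace M ->
  GapL (fun x => gap x (T x) (init M)).
Proof.
move=> bnd logM; exists M; split=> [x||x] //; first by exists (T x); apply: bnd.
pose s := halting_paths x (T x) (init M).
have mem_s p : (p \in s) = halting_from x predT (init M) p.
  by rewrite mem_halting_paths //; apply: bnd.
pose sP P := filter (halting_from x P (init M)) s.
have sPP P : Defs.has_count (halting_from x P (init M)) (size (sP P)).
  exists (sP P); split=> // [|p]; first exact/filter_uniq/halting_paths_uniq.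
  rewrite mem_filter mem_s /halting_from.
  by case: run_from => // c; case: (halted x c); rewrite ?andbT ?andbF.
exists (size (sP (fun c => cstate c \in accepting M))).
exists (size (sP (fun c => cstate c \notin accepting M))).
by split; [exact: sPP | exact: sPP | rewrite gap_count !size_filter].
Qed.

(** * One-pass automata as machines, and signed counts of walks *)

Section Automaton.
Variables (Sigma V : finType) (v0 : V) (init_set : {set V}) (next : V -> {set V}).
Variable final : {set V}.

Definition right_moves (A : {set V}) : {set V * unit * dir * dir} :=
  [set (q, tt, GoRight, Stay) | q in A].

(** The left marker chooses the first vertex of a walk, each letter extends the walk by one edge,
    and the right marker halts. Only right moves occur, so the input position is the path length. *)
Definition automaton_delta (q : V) (s : insym Sigma) (_ : unit) :=
  match s with
  | LeftMark => right_moves init_set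
  | Letter _ => right_moves (next q)
  | RightMark => set0
  end.

Fact automaton_delta_left q g q' b dw :
  (q', b, GoLeft, dw) \notin automaton_delta q LeftMark g.
Proof. by apply/imsetP => -[]. Qed.

Fact automaton_delta_right q g q' b dw :
  (q', b, GoRight, dw) \notin automaton_delta q RightMark g.
Proof. by rewrite inE. Qed.

Definition automaton : ntm Sigma :=
  NTM tt v0 final automaton_delta_left automaton_delta_right.

Fixpoint walk_gap (n : nat) (q : V) : int :=
  if n is n'.+1 then \sum_(q' in next q) walk_gap n' q'
  else (-1) ^+ (q \notin final).

Lemma big_right_moves (A : {set V}) (F : V * unit * dir * dir -> int) :
  \sum_(m in right_moves A) F m = \sum_(q in A) F (q, tt, GoRight, Stay).
Proof. by rewrite big_imset //= => q q' _ _ []. Qed.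

Lemma right_moves_eq0 (A : {set V}) : (right_moves A == set0) = (A == set0).
Proof.
apply/eqP/eqP => [A0 | ->]; last exact: imset0.
apply/setP => q; rewrite inE; apply/negP => qA.
by have := imset_f (fun q => (q, tt, GoRight, Stay)) qA; rewrite -/(right_moves A) A0 inE.
Qed.

Lemma run_automaton x p (c c' : config automaton) :
  run_from x c p = Some c' -> (ipos c <= (size x).+1)%N ->
  [/\ ipos c' = (ipos c + size p)%N, (ipos c' <= (size x).+1)%N & wpos c' = wpos c].
Proof.
elim: p c => [|m p IHp] c /=; first by move=> [<-]; rewrite addn0.
rewrite /moves; case: ifP => // mc rc ic.
have [q mE] : exists q, m = (q, tt, GoRight, Stay).
  move: mc; rewrite /= /automaton_delta; case: read_input => [||a]; rewrite ?inE //.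
    by move=> /imsetP [q _ ->]; exists q.
  by move=> /imsetP [q _ ->]; exists q.
subst m; have := IHp _ rc; rewrite /= addSnnS; apply.
move: mc ic; rewrite /= /automaton_delta; case: (ipos c) => [|k] //=.
have [lt_k|ge_k] := ltnP k (size x); first by [].
by rewrite onth_default ?inE.
Qed.

(** At this position exactly [n] letters remain to be read. Without dead ends no walk halts early;
    an early halt would count as 1 or -1, an empty sum as 0. *)
Lemma gap_automaton x n (c : config automaton) :
  (forall q, next q != set0) -> ipos c = (size x - n).+1 -> (n <= size x)%N ->
  gap x n c = walk_gap n (cstate c).
Proof.
move=> next0; elim: n c => [|n IHn] c /= ic le_n; rewrite /halted /moves /= ic /=.
  by rewrite onth_default ?subn0 // eqxx.
have : onth x (size x - n.+1) by rewrite onthTE; lia.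
case: onth => //= a _; rewrite right_moves_eq0 (negPf (next0 _)).
rewrite big_right_moves; apply: eq_bigr => q _.
by rewrite IHn //= ?ic; lia.
Qed.

Lemma GapL_automaton :
  init_set != set0 -> (forall q, next q != set0) ->
  GapL (fun x : seq Sigma => \sum_(q in init_set) walk_gap (size x) q).
Proof.
move=> init0 next0.
have [bnd logM] : (forall x p c, run automaton x p = Some c -> (size p <= (size x).+1)%N)
    /\ logspace automaton.
  split=> [x p c rc | ]; first by have [ic + _] := run_automaton rc isT; rewrite ic.
  by exists 0%N => x p c rc; have [_ _ ->] := run_automaton rc isT.
(* The same machine is reused, its gap being matched with the desired function input by input. *)
have [M [haltM logM' gapM]] := GapL_gap bnd logM.
exists M; split=> // x; have [a [r [ha hr fx]]] := gapM x.
exists a, r; split=> //; rewrite -fx /= /halted /moves /= right_moves_eq0 (negPf init0).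
rewrite big_right_moves; apply: eq_bigr => q _.
by rewrite gap_automaton //= subnn.
Qed.

End Automaton.

(** * Linear recurrences *)

Section LinearRecurrence.
Variables (Sigma I : finType) (i0 : I).

(* A state [(i, s, k)] stands for the [k]-th copy of the index [i] with sign [s]
   ([s = true] is negative). The copy [0] is always entered with both signs, so
   it contributes nothing and merely prevents dead ends. *)
Definition weighted_set K (a : I -> int) (s : bool) : {set I * bool * 'I_K.+1} :=
  [set t | (t.2 == ord0) ||
           (t.2 <= `|a t.1.1|)%N && (t.1.2 == s (+) (a t.1.1 < 0))].

Lemma weighted_set_neq0 K a s : weighted_set K a s != set0.
Proof. by apply/set0Pn; exists (i0, false, ord0); rewrite inE eqxx. Qed.

(** The two signs of copy 0 cancel; copies 1 to [|a i|] each contribute [F i] with the sign of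
    [a i], twisted by [s]. *)
Lemma sum_weighted_set K (a : I -> int) s (F : I -> int) :
  (forall i, (`|a i| <= K)%N) ->
  \sum_(t in weighted_set K a s) (-1) ^+ t.1.2 * F t.1.1
    = (-1) ^+ s * \sum_i a i * F i.
Proof.
move=> aK.
have -> : \sum_(t in weighted_set K a s) (-1) ^+ t.1.2 * F t.1.1
    = \sum_i \sum_b \sum_k
        (if (i, b, k) \in weighted_set K a s then (-1) ^+ b * F i else 0).
  by rewrite big_mkcond !pair_bigA; apply: eq_bigr => -[[i b] k].
rewrite mulr_sumr; apply: eq_bigr => i _; rewrite exchange_big big_ord_recl /=.
rewrite big_bool !inE /= mulNr addNr add0r.
pose c := (-1) ^+ s * ((-1) ^+ (a i < 0)%R * F i).
rewrite (eq_bigr (fun k : 'I_K => if (k < `|a i|)%N then c else 0)); last first.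
  move=> k _; rewrite big_bool !inE /= /bump /= add1n {}/c.
  by case: leqP => //= _; case: s; case: (a i < 0); rewrite /= ?expr0 ?expr1; ring.
rewrite -big_mkcond -(big_ord_widen K (fun=> c)) // sumr_const card_ord.
by rewrite -mulr_natl natz {2}[a i]intEsign /c; ring.
Qed.

Lemma GapL_recurrence_ones (A : I -> I -> int) (w : nat -> I -> int) (u : I -> int) :
  (forall i, w 0%N i = 1) ->
  (forall n i, w n.+1 i = \sum_j A i j * w n j) ->
  GapL (fun x : seq Sigma => \sum_i u i * w (size x) i).
Proof.
move=> w0 wS.
(* One bound for all weights, so that a single vertex set serves both the initial choice and every
   transition. *)
pose K := (\sum_i `|u i| + \sum_i \sum_j `|A i j|)%N.
have uK i : (`|u i| <= K)%N by rewrite /K (bigD1 i) //=; lia.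
have AK i j : (`|A i j| <= K)%N.
  by rewrite /K [X in (_ + X)%N](bigD1 i) //= [X in (_ + (X + _))%N](bigD1 j) //=; lia.
pose next (t : I * bool * 'I_K.+1) := weighted_set K (A t.1.1) t.1.2.
pose final := [set t : I * bool * 'I_K.+1 | ~~ t.1.2].
have gapE n t : walk_gap next final n t = (-1) ^+ t.1.2 * w n t.1.1.
  elim: n t => [|n IHn] t /=; first by rewrite inE negbK w0 mulr1.
  by under eq_bigr => t' _ do rewrite IHn; rewrite sum_weighted_set // wS.
have [M [haltM logM gapM]] := @GapL_automaton Sigma _ (i0, false, ord0 : 'I_K.+1)
  (weighted_set K u false) next final
  (weighted_set_neq0 K u false) (fun t => weighted_set_neq0 K (A t.1.1) t.1.2).
exists M; split=> // x; have [a [r [ha hr fx]]] := gapM x.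
exists a, r; split=> //; rewrite -fx.
under [RHS]eq_bigr => t _ do rewrite gapE.
by rewrite sum_weighted_set // expr0 mul1r.
Qed.

End LinearRecurrence.

(* The initial values are normalized to 1 by adding [(1 - w 0 i) * e n] to
   [w n i], where the extra sequence [e] is 1 at 0 and 0 afterwards. *)
Lemma GapL_recurrence (Sigma I : finType) (A : I -> I -> int) (w : nat -> I -> int)
    (u : I -> int) :
  (forall n i, w n.+1 i = \sum_j A i j * w n j) ->
  GapL (fun x : seq Sigma => \sum_i u i * w (size x) i).
Proof.
move=> wS.
pose e n : int := (n == 0)%N%:R.
pose w' n (o : option I) := if o is Some i then w n i + (1 - w 0%N i) * e n else e n.
(* The weights on [None], here and in [A'], cancel the corrections [(1 - w 0 i) * e n]; the row of
   [None] is zero because [e] vanishes after 0. *)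
pose u' (o : option I) :=
  if o is Some i then u i else \sum_i u i * (w 0%N i - 1).
pose A' (o o' : option I) :=
  if o is Some i then
    if o' is Some j then A i j else \sum_j A i j * (w 0%N j - 1)
  else 0.
have big_opt (F : option I -> int) : \sum_o F o = F None + \sum_i F (Some i).
  rewrite (bigD1 None) //=; congr (_ + _).
  rewrite (reindex_omap (Some : I -> option I) id) => [|[]] //=.
  by apply: eq_bigl => i; rewrite eqxx.
have [||M [haltM logM gapM]] := @GapL_recurrence_ones Sigma _ None A' w' u'.
- by case=> [i|] //=; rewrite /e eqxx mulr1 addrC subrK.
- move=> n [i|] /=; last by rewrite big1 // => j _; rewrite mul0r.
  rewrite big_opt /= wS mulr0 addr0 mulr_suml -big_split /=.
  by apply: eq_bigr => j _; ring.
exists M; split=> // x; have [a [r [ha hr fx]]] := gapM x.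
exists a, r; split=> //; rewrite -fx big_opt /= mulr_suml -big_split /=.
by apply: eq_bigr => j _; ring.
Qed.

(** All values so far, newest first. The default 0 of [nth] plays the part of the values at negative
    indices. *)
Fixpoint recurrence_values (c : nat -> int) (d n : nat) : seq int :=
  if n is n'.+1 then
    let s := recurrence_values c d n' in \sum_(i < d) c i * s`_i :: s
  else [:: 1].

Definition linear_recurrence c d n := (recurrence_values c d n)`_0.

Lemma nth_recurrence_values c d n i :
  (recurrence_values c d n)`_i =
    if (i <= n)%N then linear_recurrence c d (n - i) else 0.
Proof.
elim: n i => [|n IHn] [|i] //=.
exact: nth_nil.
Qed.

Lemma linear_recurrenceS c d n :
  (forall i, (d <= i)%N -> c i = 0) ->
  linear_recurrence c d n.+1 = \sum_(i < n.+1) c i * linear_recurrence c d (n - i).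
Proof.
move=> c0; rewrite {1}/linear_recurrence /=.
pose F i := c i * (recurrence_values c d n)`_i.
transitivity (\sum_(i < d + n.+1) F i).
  rewrite big_split_ord /= [X in _ + X]big1 ?addr0 // => i _.
  by rewrite /F c0 ?mul0r // leq_addr.
rewrite addnC big_split_ord /= [X in _ + X]big1 ?addr0.
  by apply: eq_bigr => i _; rewrite /F nth_recurrence_values -ltnS ltn_ord.
by move=> i _; rewrite /F nth_recurrence_values leqNgt ltnS leq_addr mulr0.
Qed.

(** The window of the last [d.+1] values evolves by the companion matrix [A]; both terms are linear
    forms in that window. *)
Lemma GapL_linear_recurrence (Sigma : finType) c d (a b : int) :
  GapL (fun x : seq Sigma => a * linear_recurrence c d.+1 (size x).+1
                           + b * linear_recurrence c d.+1 (size x)).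
Proof.
pose w n (i : 'I_d.+1) := (recurrence_values c d.+1 n)`_i.
pose A (i j : 'I_d.+1) : int := if i == ord0 then c j else (j.+1 == i)%N%:R.
pose u (j : 'I_d.+1) := a * c j + b * (j == ord0)%:R.
have wS n i : w n.+1 i = \sum_j A i j * w n j.
  rewrite /w /A; have [-> //|i0] := eqVneq i ord0.
  case: i i0 => [[|i] lt_i] // _ /=.
  rewrite (bigD1 (Ordinal (ltnW lt_i))) //= eqxx mul1r big1 ?addr0 // => j.
  by rewrite -val_eqE /= eqSS => /negPf ->; rewrite mul0r.
have [M [haltM logM gapM]] := GapL_recurrence Sigma u wS.
exists M; split=> // x; have [m [r [hm hr fx]]] := gapM x.
exists m, r; split=> //; rewrite -fx /u.
under [RHS]eq_bigr => j _ do rewrite mulrDl -!mulrA.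
rewrite big_split /= -!mulr_sumr; congr (_ * _ + _ * _).
rewrite big_ord_recl eqxx mul1r big1 ?addr0 // => j _.
by rewrite -val_eqE mul0r.
Qed.

(** * Bernoulli's method *)

Section InverseSeries.
Variable R : realFieldType.

(* The convolution hypothesis says that [t] is a multiple of the power series [1/Q]. *)
Lemma inverse_series_bound (Q : {poly R}) (t : nat -> R) (B : R) :
  Q`_0 != 0 -> 1 <= B -> \sum_(i < size Q) `|Q`_i.+1| <= B * `|Q`_0| ->
  (forall n, \sum_(j < n.+2) Q`_j * t (n.+1 - j)%N = 0) ->
  forall n, `|t n| <= `|t 0%N| * B ^+ n.
Proof.
move=> Q0 B1 QB conv n; have [m le_nm] := ubnP n.
elim: m n le_nm => // m IHm [|n]; first by rewrite expr0 mulr1.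
rewrite ltnS => lt_nm; have := conv n; rewrite big_ord_recl /= subn0 => /eqP.
rewrite addr_eq0 => /eqP Qt.
have Q0gt : 0 < `|Q`_0| by rewrite normr_gt0.
rewrite -(ler_pM2l Q0gt) -normrM Qt normrN.
apply: le_trans (ler_norm_sum _ _ _) _.
(* Since [1 <= B], the inductive bounds at all earlier indices are weakened to the one at [n]. *)
apply: (@le_trans _ _ (\sum_(i < n.+1) `|Q`_i.+1| * (`|t 0%N| * B ^+ n))).
  apply: ler_sum => i _; rewrite /bump /= add1n subSS normrM ler_wpM2l //.
  apply: (le_trans (IHm _ _)); first by lia.
  by rewrite ler_wpM2l // ler_weXn2l // leq_subr.
have tB : 0 <= `|t 0%N| * B ^+ n by rewrite mulr_ge0 ?exprn_ge0 //; lra.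
have sumQ : \sum_(i < n.+1) `|Q`_i.+1| <= \sum_(i < size Q) `|Q`_i.+1|.
  have -> : \sum_(i < size Q) `|Q`_i.+1| = \sum_(i < size Q + n.+1) `|Q`_i.+1|.
    rewrite big_split_ord /= [X in _ = _ + X]big1 ?addr0 // => i _.
    by rewrite nth_default ?normr0 //; lia.
  by rewrite addnC big_split_ord /= lerDl sumr_ge0.
rewrite -mulr_suml exprS.
apply: (le_trans (ler_wpM2r tB (le_trans sumQ QB))).
by rewrite le_eqVlt; apply/orP; left; apply/eqP; ring.
Qed.

(** The error equals [t n.+1 / u n.+1], whose numerator grows at most like [B ^+ n] and whose
    denominator at least like [(4 * B) ^+ n]. *)
Lemma inverse_series_ratio (u t : nat -> R) (delta B : R) :
  1 <= B -> 8 * B * `|delta| <= 1 -> t 0%N != 0 ->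
  (forall n, `|t n| <= `|t 0%N| * B ^+ n) ->
  t 0%N = - (delta * u 0%N) -> (forall n, t n.+1 = u n - delta * u n.+1) ->
  forall n, u n.+1 != 0 /\ `|u n / u n.+1 - delta| < 2 ^- n.
Proof.
move=> B1 dB t0 tB tu0 tuS.
have tgt : 0 < `|t 0%N| by rewrite normr_gt0.
have B0 : 0 < B by lra.
have udB n : 8 * B * (`|delta| * `|u n|) <= `|u n|.
  by rewrite mulrA; apply: ler_piMl.
(* Subtracting [t n.+1] from [u n] costs at most half of the lower bound; dividing by [delta] gains
   [8 * B], which leaves a factor [4 * B]. *)
have ugrow n : 2 * B * (4 * B) ^+ n * `|t 0%N| <= `|u n|.
  elim: n => [|n IHn].
    rewrite expr0 mulr1; apply: le_trans (udB 0%N).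
    by rewrite -[`|delta| * _]normrM -[`|delta * _|]normrN -tu0; nra.
  apply: le_trans (udB n.+1).
  have : `|u n| - `|t n.+1| <= `|delta| * `|u n.+1|.
    rewrite -normrM; have -> : delta * u n.+1 = u n - t n.+1 by rewrite tuS; ring.
    exact: lerB_dist.
  have := tB n.+1; have one4 : 1 <= (4 : R) ^+ n by apply: exprn_ege1; lra.
  have Bn : 0 < B ^+ n by apply: exprn_gt0.
  move: IHn; rewrite !exprMn !exprS.
  set b := B ^+ n in Bn *; set f := 4 ^+ n in one4 *.
  set T := `|t 0%N| in tgt *; set U := `|u n|; set D := _ * `|u n.+1|.
  set T' := `|t n.+1| => h1 h2 h3.
  have : T * (B * b) * f <= D.
    have : 0 < T * (B * b) by rewrite !mulr_gt0.
    move: h1 h2 h3; have -> : 2 * B * (f * b) * T = 2 * f * (T * (B * b)) by ring.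
    by nra.
  rewrite -(@ler_pM2l _ (8 * B)) ?mulr_gt0 // => h.
  by apply: le_trans h; rewrite le_eqVlt; apply/orP; left; apply/eqP; ring.
move=> n.
have ugt : 0 < `|u n.+1|.
  by apply: lt_le_trans (ugrow n.+1); rewrite !mulr_gt0 ?exprn_gt0 ?mulr_gt0.
have un0 : u n.+1 != 0 by rewrite -normr_gt0.
split=> //.
have -> : u n / u n.+1 - delta = t n.+1 / u n.+1 by rewrite tuS; field.
rewrite normf_div ltr_pdivrMr //.
apply: le_lt_trans (tB n.+1) _.
rewrite ltr_pdivlMl ?exprn_gt0 //.
apply: lt_le_trans (ugrow n.+1).
have le24 : (2 : R) ^+ n <= 4 ^+ n by apply: lerXn2r; rewrite ?nnegrE //; lra.
have Bn : 0 < B ^+ n by apply: exprn_gt0.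
have two0 : 0 < (2 : R) ^+ n by apply: exprn_gt0.
rewrite !exprMn !exprS.
set b := B ^+ n in Bn *; set f := 4 ^+ n in le24 *; set g := 2 ^+ n in le24 two0 *.
have TBb : 0 < `|t 0%N| * (B * b) by rewrite !mulr_gt0.
rewrite [g * _]mulrC.
have -> : 2 * B * (4 * f * (B * b)) * `|t 0%N| = `|t 0%N| * (B * b) * (8 * B * f) by ring.
rewrite ltr_pM2l //; nra.
Qed.

(** The factor [P_0 ^+ i] in [c i] comes from multiplying the recurrence of the coefficients of
    [1/P] by powers of [P_0], which keeps [v] integral. *)
Lemma inverse_poly_ratio (P : {poly int}) (Q : {poly R}) (delta B : R) :
  let c i := - (P`_i.+1 * P`_0 ^+ i) in
  let v n := (linear_recurrence c (size P) n)%:~R : R in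
  map_poly intr P = ('X - delta%:P) * Q -> delta != 0 -> Q`_0 != 0 ->
  1 <= B -> \sum_(i < size Q) `|Q`_i.+1| <= B * `|Q`_0| -> 8 * B * `|delta| <= 1 ->
  forall n, v n.+1 != 0 /\ `|(P`_0)%:~R * v n / v n.+1 - delta| < 2 ^- n.
Proof.
move=> c v PQ d0 Q0 B1 QB dB.
pose P0 : R := (P`_0)%:~R.
have PE : P0 = - (delta * Q`_0).
  by rewrite /P0 -coef_map /= PQ coefM big_ord1 coefB coefX coefC /=; ring.
have P00 : P0 != 0 by rewrite PE oppr_eq0 mulf_neq0.
pose u n := v n / P0 ^+ n.+1.
have vS n : v n.+1 = - \sum_(i < n.+1) (P`_i.+1)%:~R * P0 ^+ i * v (n - i)%N.
  rewrite /v linear_recurrenceS.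
    rewrite rmorph_sum -sumrN; apply: eq_bigr => i _.
    by rewrite rmorphM rmorphN rmorphM rmorphXn /= mulNr.
  by move=> i le_i; rewrite /c nth_default ?mul0r ?oppr0 // leqW.
have u0 : P0 * u 0%N = 1 by rewrite /u /v /= expr1 mul1r divff.
have uS n : \sum_(j < n.+2) (P`_j)%:~R * u (n.+1 - j)%N = 0.
  rewrite big_ord_recl subn0 -/P0.
  have -> : P0 * u n.+1 = v n.+1 / P0 ^+ n.+1.
    by rewrite /u [P0 ^+ n.+2]exprS; field; rewrite P00 expf_neq0.
  rewrite vS mulNr mulr_suml -sumrN -big_split big1 //= => i _.
  rewrite /bump add1n subSS /u.
  have -> : P0 ^+ n.+1 = P0 ^+ i * P0 ^+ (n - i).+1 by rewrite -exprD addnS subnKC // -ltnS.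
  by field; rewrite !expf_neq0.
pose t n := (if n is n'.+1 then u n' else 0) - delta * u n.
have convQ n : \sum_(j < n.+2) Q`_j * t (n.+1 - j)%N = 0.
  (* Truncating the series [u] leaves the coefficients up to index [n.+1] of its products
     unchanged. *)
  pose U := \poly_(i < n.+2) u i.
  have tU i : (i < n.+2)%N -> (('X - delta%:P) * U)`_i = t i.
    move=> lt_i; rewrite mulrBl coefB coefXM coefCM !coef_poly lt_i /t.
    by case: i lt_i => //= i lt_i; rewrite ltnW.
  transitivity ((Q * (('X - delta%:P) * U))`_n.+1).
    by rewrite coefM; apply: eq_bigr => j _; rewrite tU // ltnS leq_subr.
  rewrite mulrA [Q * _]mulrC -PQ coefM -[RHS](uS n).
  by apply: eq_bigr => j _; rewrite coef_map coef_poly ltnS leq_subr.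
have t0 : t 0%N = - (delta * u 0%N) by rewrite /t sub0r.
have t00 : t 0%N != 0.
  rewrite t0 oppr_eq0 mulf_neq0 //; apply: contra_eq_neq u0 => ->.
  by rewrite mulr0 eq_sym oner_eq0.
move=> n.
have [un0 ur] := inverse_series_ratio B1 dB t00 (inverse_series_bound Q0 B1 QB convQ)
  t0 (fun=> erefl) n.
have vn0 : v n.+1 != 0 by apply: contra_neq un0 => v0; rewrite /u v0 mul0r.
split=> //; move: ur; rewrite /u.
have -> // : v n / P0 ^+ n.+1 / (v n.+1 / P0 ^+ n.+2) = (P`_0)%:~R * v n / v n.+1.
rewrite -/P0 [P0 ^+ n.+2]exprS; field.
by rewrite vn0 P00 expf_neq0.
Qed.

End InverseSeries.

(** * Choice of the shift *)

(** Differentiate as long as [alpha] remains a root of the derivative; in characteristic 0 this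
    derivative is nonzero and of smaller size. *)
Lemma algebraic_simple_root (R : numFieldType) (alpha : R) :
  algebraicOver (ratr : rat -> R) alpha ->
  exists (p : {poly rat}) (q : {poly R}),
    map_poly ratr p = ('X - alpha%:P) * q /\ q.[alpha] != 0.
Proof.
case=> p; have [n] := ubnP (size p); elim: n p => // n IHn p le_n p0 pa.
have [p'a | np'a] := boolP (root (map_poly ratr p)^`() alpha).
  have gt1 : (1 < size p)%N.
    rewrite ltnNge; apply/negP => /size1_polyC pE; move: p0 pa.
    by rewrite pE map_polyC rootC polyC_eq0 fmorph_eq0 => /negPf ->.
  apply: (IHn p^`()); last by rewrite -deriv_map.
    by have := lt_size_deriv p0; lia.
  apply/eqP => /(congr1 (fun s : {poly rat} => s`_(size p).-2)) /eqP.
  rewrite coef_deriv coef0 -mulr_natr mulf_eq0 pnatr_eq0 orbF.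
  by rewrite prednK -?lead_coefE ?lead_coef_eq0 ?(negPf p0) //; lia.
have [q pq] := factor_theorem _ _ pa; exists p, q; split; first by rewrite pq mulrC.
move: np'a; rewrite pq /root derivM derivXsubC !hornerE.
by rewrite subrr mulr0 add0r.
Qed.

Definition horner_bound (R : numDomainType) (q : {poly R}) (a : R) : R :=
  \sum_(i < size q) `|q`_i| * (`|a| + 1) ^+ i.

Lemma horner_bound_ge0 (R : numDomainType) (q : {poly R}) a : 0 <= horner_bound q a.
Proof. by apply: sumr_ge0 => i _; rewrite mulr_ge0 ?exprn_ge0 ?addr_ge0. Qed.

Lemma horner_boundP (R : numDomainType) (q : {poly R}) a x :
  `|x - a| <= 1 -> `|q.[x]| <= horner_bound q a.
Proof.
move=> xa; rewrite horner_coef; apply: le_trans (ler_norm_sum _ _ _) _.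
apply: ler_sum => i _; rewrite normrM normrX ler_wpM2l //.
apply: lerXn2r; rewrite ?nnegrE ?addr_ge0 //.
by rewrite -lerBlDl (le_trans (lerB_dist _ _)).
Qed.

(** Taylor expansion at [r], with divided derivatives. *)
Lemma coef_comp_XaddC (R : comNzRingType) (q : {poly R}) r i :
  (q \Po ('X + r%:P))`_i = q^`N(i).[r].
Proof.
have cXr : GRing.comm (r%:P : {poly R}) 'X by rewrite /GRing.comm mulrC.
rewrite addrC /comp_poly nderiv_taylor // size_map_polyC.
under eq_bigr => j _ do rewrite nderivn_map horner_map /=.
rewrite coef_sum; under eq_bigr => j _ do rewrite coefCM coefXn.
have [lt_i | ge_i] := ltnP i (size q).
  rewrite (bigD1 (Ordinal lt_i)) //= eqxx mulr1 big1 ?addr0 // => j.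
  by rewrite -val_eqE eq_sym => /negPf /= ->; rewrite mulr0.
rewrite big1 => [|j _]; last by rewrite gtn_eqF ?mulr0 // (leq_trans (ltn_ord j)).
by rewrite nderivn_poly0 ?horner0.
Qed.

(* [B] is uniform in [r], so that [r] can afterwards be moved close to [alpha]
   relative to [1/B]. *)
Lemma shift_coef_bound (R : realFieldType) (q : {poly R}) (alpha : R) :
  q.[alpha] != 0 ->
  exists B eps : R, [/\ 1 <= B, 0 < eps & forall r, `|r - alpha| < eps ->
    let Q := q \Po ('X + r%:P) in
    [/\ Q`_0 != 0, \sum_(i < size Q) `|Q`_i.+1| <= B * `|Q`_0|
      & 8 * B * `|r - alpha| <= 1]].
Proof.
move=> qa0; set k := `|q.[alpha]|; have k0 : 0 < k by rewrite normr_gt0.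
have [h qE] : exists h, q - q.[alpha]%:P = h * ('X - alpha%:P).
  by apply/factor_theorem; rewrite /root !hornerE subrr.
pose H := horner_bound h alpha; have H0 : 0 <= H := horner_bound_ge0 _ _.
pose M := \sum_(i < size q) horner_bound q^`N(i.+1) alpha.
have M0 : 0 <= M by apply: sumr_ge0 => i _; apply: horner_bound_ge0.
(* Within [e1] of [alpha], [q] moves by at most [k / 2], so [|q.[r]|] stays at least [k / 2], and
   [B * (k / 2)] exceeds the bound [M] on the higher Taylor coefficients. [e2] gives the last
   inequality. *)
pose B := 1 + 2 * M / k; pose e1 := k / (2 * (H + 1)); pose e2 := (8 * B)^-1.
have B1 : 1 <= B by rewrite lerDl divr_ge0 ?mulr_ge0 // ltW.
have e10 : 0 < e1 by rewrite divr_gt0 //; lra.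
have e20 : 0 < e2 by rewrite invr_gt0; lra.
exists B, (Num.min 1 (Num.min e1 e2)); split=> // [|r]; first by rewrite !lt_min ltr01 e10.
rewrite !lt_min => /and3P [r1 re1 re2] Q.
have Q0E : Q`_0 = q.[r] by rewrite coef_comp_XaddC nderivn0.
have qr : k / 2 <= `|q.[r]|.
  have rE : q.[alpha] = q.[r] - h.[r] * (r - alpha).
    have := congr1 (fun s : {poly R} => s.[r]) qE; rewrite !hornerE => <-; ring.
  have hr : `|h.[r] * (r - alpha)| <= k / 2.
    rewrite normrM; have := horner_boundP h (ltW r1); rewrite -/H => hH.
    apply: (le_trans (ler_pM _ _ hH (ltW re1))) => //.
    by rewrite /e1 mulrA ler_pdivrMr; [nra | lra].
  have : k <= `|q.[r]| + `|h.[r] * (r - alpha)| by rewrite /k {1}rE ler_normB.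
  by lra.
split; first by rewrite Q0E -normr_gt0; lra.
  have sQ : size Q = size q by rewrite size_comp_poly2 // size_XaddC.
  apply: (@le_trans _ _ M).
    rewrite sQ; apply: ler_sum => i _; rewrite coef_comp_XaddC.
    exact/horner_boundP/ltW.
  rewrite Q0E; apply: (@le_trans _ _ (B * (k / 2))); last by rewrite ler_wpM2l //; lra.
  have -> : B * (k / 2) = k / 2 + M by rewrite /B; field; lra.
  by lra.
by rewrite mulrC -ler_pdivlMr ?div1r ?ltW //; lra.
Qed.

(** * Assembly of the approximating quotients *)

Theorem theorem5 (R : realType) (Sigma : finType) (one : Sigma) (alpha : R) :
  algebraicOver (ratr : rat -> R) alpha -> GapL_approximable one alpha.
Proof.
move=> /algebraic_simple_root [p [q [pq qa0]]].
have [B [eps [B1 eps0 near]]] := shift_coef_bound qa0.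
(* The open interval excludes [alpha], so the shifted root [alpha - ratr r] is nonzero even for
   rational [alpha]. *)
have [r] : exists r : rat, ratr r \in `]alpha, (alpha + eps)[.
  by apply: rat_in_itvoo; rewrite ltrDl.
rewrite in_itv /= => /andP [lt_ar lt_re].
have [|Q0 QB rB] := near (ratr r); first by rewrite gtr0_norm ?subr_gt0 // ltrBlDl.
set Q := q \Po _ in Q0 QB.
(* Clearing denominators scales [Q] by [a], which preserves its coefficient inequality with the same
   [B]. *)
have [z [a a0 zE]] := rat_poly_scale (p \Po ('X + r%:P)).
pose a' : R := a%:~R; have a'0 : a' != 0 by rewrite intr_eq0.
have zQ : map_poly intr z = ('X - (alpha - ratr r)%:P) * (a' *: Q).
  have -> : map_poly intr z = a' *: map_poly ratr (p \Po ('X + r%:P)) :> {poly R}.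
    rewrite zE map_polyZ /= fmorphV rmorph_int scalerA divff // scale1r -map_poly_comp.
    by apply: eq_map_poly => m /=; rewrite ratr_int.
  rewrite map_comp_poly pq rmorphD /= map_polyX map_polyC comp_polyM -scalerAr.
  by rewrite comp_polyB comp_polyX comp_polyC polyCB opprB addrA.
have d0 : alpha - ratr r != 0 by rewrite subr_eq0 lt_eqF.
have aQ0 : (a' *: Q)`_0 != 0 by rewrite coefZ mulf_neq0.
have aQB : \sum_(i < size (a' *: Q)) `|(a' *: Q)`_i.+1| <= B * `|(a' *: Q)`_0|.
  rewrite size_scale //; under eq_bigr => i _ do rewrite coefZ normrM.
  by rewrite -mulr_sumr coefZ normrM mulrCA ler_pM2l ?normr_gt0.
rewrite distrC in rB.
have approx := inverse_poly_ratio zQ d0 aQ0 B1 aQB rB.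
have [d sz] : exists d, size z = d.+1.
  case sz: (size z) => [|d]; last by exists d.
  move/eqP: sz zQ; rewrite size_poly_eq0 => /eqP ->; rewrite rmorph0.
  move/esym/eqP; rewrite mulf_eq0 polyXsubC_eq0 /= => /eqP Q00.
  by rewrite Q00 coef0 eqxx in aQ0.
rewrite sz in approx; set c := fun i => _ in approx.
(* Adding [r] back to the approximation of [alpha - ratr r], over the common denominator
   [denq r * v n.+1], where [v] is the recurrence sequence. *)
exists (fun x => numq r * linear_recurrence c d.+1 (size x).+1
   + (denq r * z`_0) * linear_recurrence c d.+1 (size x)).
exists (fun x => denq r * linear_recurrence c d.+1 (size x).+1
   + 0 * linear_recurrence c d.+1 (size x)).
split; [exact: GapL_linear_recurrence | exact: GapL_linear_recurrence | move=> n].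
have [v0 close] := approx n; rewrite size_nseq mul0r addr0; split.
  by rewrite mulf_neq0 ?denq_neq0 //; move: v0; rewrite intr_eq0.
have -> // : (numq r * linear_recurrence c d.+1 n.+1
     + denq r * z`_0 * linear_recurrence c d.+1 n)%:~R
     / (denq r * linear_recurrence c d.+1 n.+1)%:~R - alpha
   = (z`_0)%:~R * (linear_recurrence c d.+1 n)%:~R / (linear_recurrence c d.+1 n.+1)%:~R
     - (alpha - ratr r) :> R.
have dr0 : (denq r)%:~R != 0 :> R by rewrite intr_eq0 denq_neq0.
by rewrite /ratr !(rmorphD, rmorphM) /=; field; rewrite dr0 v0.
Qed.
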